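(* Let $(X,f_{1,\infty})$ be a nonautonomous dynamical system, and let $K$ be a nonempty subset of $X$. (1) If $h_{top}(f_{1,\infty},K)<+\infty$, then $0\le\overline{D}_K(f_{1,\infty})\le 1$. (2) If $0\le\overline{D}_K(f_{1,\infty})<1$, then $h_{top}(f_{1,\infty},K)<+\infty$. (3) If $D(f_{1,\infty},K,1)<+\infty$, then $0\le D(f_{1,\infty},K)\le 1$. (4) If $0\le D(f_{1,\infty},K)<1$, then $D(f_{1,\infty},K,1)<+\infty$.
   Context: A nonautonomous dynamical system (NDS) $(X,f_{1,\infty})$ consists of a compact topological space $X$ and a sequence $f_{1,\infty}=(f_i)_{i\ge 1}$ of continuous maps $f_i:X\to X$. Put $f_1^0=\mathrm{id}_X$, $f_1^j=f_j\circ\cdots\circ f_1$, and let $f_1^{-j}(A)=(f_1^j)^{-1}(A)$ denote preimages. Classical quantities. For a finite open cover $\mathcal{U}$ of $X$ let $\mathcal{U}_1^n$ be the cover of all sets $\bigcap_{j=0}^{n-1}f_1^{-j}(U_j)$ with $U_j\in\mathcal{U}$, and let $\mathcal{N}(\mathcal{U}_1^n|_K)$ be the minimal number of members of $\{V\cap K: V\in\mathcal{U}_1^n\}$ needed to cover $K$. For $s>0$ set $\overline{h}_K(f_{1,\infty},s)=\sup_{\mathcal{U}}\limsup_{n\to\infty}\frac{1}{n^s}\log\mathcal{N}(\mathcal{U}_1^n|_K)$, supremum over finite open covers of $X$. The topological entropy is $h_{top}(f_{1,\infty},K)=\overline{h}_K(f_{1,\infty},1)$ and the upper topological entropy dimension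 is $\overline{D}_K(f_{1,\infty})=\inf\{s>0:\overline{h}_K(f_{1,\infty},s)=0\}=\sup\{s>0:\overline{h}_K(f_{1,\infty},s)=\infty\}$. Pesin quantities. For a finite open cover $\mathcal{U}$ of $X$, let $S(\mathcal{U})$ be the set of all finite strings $\mathbf{U}=(U_{i_0},\dots,U_{i_{m-1}})$ of elements of $\mathcal{U}$, with length $m(\mathbf{U})=m$, and let $X(\mathbf{U})=\{x\in X: f_1^j(x)\in U_{i_j},\ 0\le j\le m(\mathbf{U})-1\}$. A collection $\mathcal{G}\subseteq S(\mathcal{U})$ covers $K$ if $K\subseteq\bigcup_{\mathbf{U}\in\mathcal{G}}X(\mathbf{U})$. For $\alpha\in\mathbb{R}$, $s>0$ let $M(f_{1,\infty},K,s,\mathcal{U},\alpha,N)=\inf_{\mathcal{G}}\sum_{\mathbf{U}\in\mathcal{G}}e^{-\alpha m(\mathbf{U})^s}$, the infimum over all finite or countable $\mathcal{G}\subseteq S(\mathcal{U})$ covering $K$ with $m(\mathbf{U})\ge N$ for all $\mathbf{U}\in\mathcal{G}$. Let $m(f_{1,\infty},K,s,\mathcal{U},\alpha)=\lim_{N\to\infty}M(f_{1,\infty},K,s,\mathcal{U},\alpha,N)$, $D(f_{1,\infty},K,s,\mathcal{U})=\inf\{\alpha: m(f_{1,\infty},K,s,\mathcal{U},\alpha)=0\}=\sup\{\alpha: m(f_{1,\infty},K,s,\mathcal{U},\alpha)=\infty\}$, and $D(f_{1,\infty},K,s)=\sup_{\mathcal{U}}D(f_{1,\infty},K,s,\mathcal{U})$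 over finite open covers $\mathcal{U}$ of $X$. The Pesin topological entropy dimension is $D(f_{1,\infty},K)=\sup\{s>0:D(f_{1,\infty},K,s)=+\infty\}=\inf\{s>0:D(f_{1,\infty},K,s)=0\}$. Conventions for sets of $s>0$: $\inf\emptyset=+\infty$, $\sup\emptyset=0$. *)

(* Defs.v *)
From HB Require Import structures.
From mathcomp Require Import all_boot all_order all_algebra.
From mathcomp Require Import all_classical all_reals all_analysis.

Set Implicit Arguments.
Unset Strict Implicit.
Unset Printing Implicit Defensive.

Import Order.TTheory GRing.Theory Num.Theory.
Import numFieldNormedType.Exports.
Local Open Scope classical_set_scope.
Local Open Scope ring_scope.

(* [iter_comp f j] is f_j o ... o f_1.  The sequence is indexed from 1: the
   value [f 0] is never used. *)
Fixpoint iter_comp (X : Type) (f : nat -> X -> X) (j : nat) : X -> X :=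
  if j is i.+1 then f i.+1 \o iter_comp f i else id.

Definition finite_open_cover (X : topologicalType) : set (set (set X)) :=
  [set U | [/\ finite_set U, U `<=` open & \bigcup_(A in U) A = [set: X]]].

(* The supremum of a set of nonnegative extended reals, with sup set0 = 0
   (whereas [ereal_sup set0] is -oo). *)
Definition nneg_ereal_sup (R : realType) (A : set (\bar R)) : \bar R :=
  if A == set0 then 0%E else ereal_sup A.

(* Three of the quantities below have two expressions, an inf and a sup, that
   agree when K is nonempty (e.g. if the entropy is finite at some s, it is 0
   at every t > s): [upper_entropy_dim] and [pesin_D_cover] are defined by the
   inf, [pesin_dim] by the sup. *)

Section Classical.
Variables (R : realType) (X : topologicalType) (f : nat -> X -> X).

Definition join_cover (U : set (set X)) (n : nat) : set (set X) :=
  [set V | exists2 u : nat -> set X,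
     (forall j, (j < n)%N -> U (u j)) &
     V = \bigcap_(j in `I_n) (iter_comp f j @^-1` u j)].

Definition covers_with (K : set X) (C : set (set X)) (k : nat) : Prop :=
  exists G : set (set X),
    [/\ G `<=` [set V `&` K | V in C], (G #= `I_k)%card &
        K `<=` \bigcup_(A in G) A].

(* The value is 0 when no finite subfamily covers K; this does not happen for
   the covers [join_cover U n] with U a finite cover. *)
Definition min_cover_number (K : set X) (C : set (set X)) : nat :=
  xget 0%N [set k | covers_with K C k /\
                    forall l, covers_with K C l -> (k <= l)%N].

Definition upper_entropy (K : set X) (s : R) : \bar R :=
  ereal_sup [set limn_esup (fun n : nat =>
      ((n%:R `^ s)^-1 * ln (min_cover_number K (join_cover U n))%:R)%:E)
    | U in @finite_open_cover X].

Definition top_entropy (K : set X) : \bar R := upper_entropy K 1.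

Definition upper_entropy_dim (K : set X) : \bar R :=
  ereal_inf [set s%:E | s in [set s : R | 0 < s /\ upper_entropy K s = 0%E]].

End Classical.

Section Pesin.
Variables (R : realType) (X : topologicalType) (f : nat -> X -> X).

Definition strings (U : set (set X)) : set (seq (set X)) :=
  [set u | (0 < size u)%N /\
           forall j, (j < size u)%N -> U (nth set0 u j)].

Definition string_set (u : seq (set X)) : set X :=
  [set x | forall j, (j < size u)%N -> nth set0 u j (iter_comp f j x)].

Definition string_covers (K : set X) (U : set (set X)) (N : nat) :
    set (set (seq (set X))) :=
  [set G | [/\ countable G, G `<=` strings U,
               K `<=` \bigcup_(u in G) string_set u &
               forall u, G u -> (N <= size u)%N]].

Definition pesin_M (K : set X) (s : R) (U : set (set X)) (a : R) (N : nat) :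
    \bar R :=
  ereal_inf [set \esum_(u in G) (expR (- (a * (size u)%:R `^ s)))%:E
    | G in string_covers K U N].

Definition pesin_m (K : set X) (s : R) (U : set (set X)) (a : R) : \bar R :=
  limn (pesin_M K s U a).

Definition pesin_D_cover (K : set X) (s : R) (U : set (set X)) : \bar R :=
  ereal_inf [set a%:E | a in [set a : R | pesin_m K s U a = 0%E]].

Definition pesin_D (K : set X) (s : R) : \bar R :=
  ereal_sup [set pesin_D_cover K s U | U in @finite_open_cover X].

Definition pesin_dim (K : set X) : \bar R :=
  nneg_ereal_sup [set s%:E | s in [set s : R | 0 < s /\ pesin_D K s = +oo%E]].

End Pesin.

(* Main.v *)
Require Import Defs.
From HB Require Import structures.
From mathcomp Require Import all_boot all_order all_algebra.
From mathcomp Require Import all_classical all_reals all_analysis.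

Import Order.TTheory GRing.Theory Num.Theory.
Import numFieldNormedType.Exports.
Local Open Scope classical_set_scope.
Local Open Scope ring_scope.
Local Open Scope ereal_scope.

(** Both parts rest on comparing the gauges [n ^ s] and [n ^ t] for [s < t].

    For the classical entropy, write [a n] for the logarithm of the cover
    number of a fixed cover.  If [a n / n ^ s] is eventually bounded by [C], then
    [a n / n ^ t <= C n ^ (s - t)] tends to [0].  So finiteness of the entropy
    at an exponent forces it to vanish at every larger exponent
    ([upper_entropy_eq0]).  Finite entropy at [1] gives vanishing at all
    [t > 1], so the infimum defining the dimension is at most [1]; conversely
    a dimension below [1] gives vanishing at some [s < 1], hence at [1].

    For the Pesin quantities, [n ^ s <= n ^ t] for [n >= 1] makes each weight
    [exp (- a n ^ t)] with [a >= 0] at most [exp (- a n ^ s)].  A critical value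
    that is finite at [s] is therefore finite at every [t >= s], with a bound
    that does not depend on the cover ([pesin_D_lty]).  Hence every exponent
    where the critical value is infinite is at most [1] as soon as it is finite
    at [1].  Conversely, if it is infinite at [1], then [1] itself is one of the
    exponents over which the supremum is taken. *)

Lemma cvg_powR_ninfty (R : realType) (p : R) :
  (0 < p)%R -> (((n%:R : R) `^ p)^-1)%R @[n --> \oo] --> (0 : R)%R.
Proof.
move=> p0; apply/cvgr0Pnorm_lt => e e0; near=> n.
have n0 : (0 < n%:R :> R)%R by near: n; exact: nbhs_infty_gtr.
rewrite ger0_norm ?invr_ge0 ?powR_ge0// invf_plt ?posrE ?powR_gt0//.
(* In this form the goal [e^-1 < n ^ p] compares two [p]-th powers, so that it
   reduces to the lower bound [e^-1 ^ p^-1 < n]. *)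
have -> : (e^-1 = (e^-1 `^ p^-1) `^ p)%R.
  by rewrite -powRrM mulVf ?gt_eqF// powRr1// invr_ge0 ltW.
rewrite gt0_ltr_powR ?nnegrE ?powR_ge0 ?ler0n//.
by near: n; exact: nbhs_infty_gtr.
Unshelve. all: by end_near. Qed.

Lemma limn_esup_lty_bounded (R : realType) (u : nat -> \bar R) :
  limn_esup u < +oo -> exists C : R, \forall n \near \oo, u n <= C%:E.
Proof.
rewrite /limn_esup limf_esupE => /ereal_inf_lt[_ [V Voo <-]].
set y := ereal_sup _ => y_lty.
have [C yC] : exists C : R, y <= C%:E.
  by case: y y_lty => [r _|//|_]; [exists r | exists 0%R; rewrite leNye].
exists C; apply: filterS Voo => n Vn.
by apply: le_trans yC; apply: ereal_sup_ubound; exists n.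
Qed.

(** The finite limsup gives [a n <= C n ^ s] eventually, whence
    [0 <= a n / n ^ t <= C / n ^ (t - s)], and the right-hand side vanishes in
    the limit because [t - s > 0]. *)
Lemma limn_esup_powR_eq0 (R : realType) (a : nat -> R) (s t : R) :
  (forall n, 0 <= a n)%R -> (s < t)%R ->
  limn_esup (fun n => ((n%:R `^ s)^-1 * a n)%:E) < +oo ->
  limn_esup (fun n => ((n%:R `^ t)^-1 * a n)%:E) = 0.
Proof.
move=> a0 st /limn_esup_lty_bounded[C aC].
suff cvg0 : (((n%:R `^ t)^-1 * a n)%R @[n --> \oo] --> (0 : R)%R).
  by apply: (cvg_limn_einf_sup _).2; apply/fine_cvgP; split; [exact: nearW|].
apply: (@squeeze_cvgr _ _ _ _ (cst 0%R)
  (fun n => (n%:R `^ (t - s))^-1 * C)%R).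
- near=> n; have n0 : (0 < n%:R :> R)%R by near: n; exact: nbhs_infty_gtr.
  rewrite mulr_ge0 ?invr_ge0 ?powR_ge0//=.
  have -> : ((n%:R : R) `^ t = n%:R `^ (t - s) * n%:R `^ s)%R.
    by rewrite -powRD ?subrK// (gt_eqF n0) implybT.
  rewrite invfM -mulrA ler_wpM2l ?invr_ge0 ?powR_ge0// -lee_fin.
  by near: n.
- exact: cvg_cst.
- rewrite -[X in _ --> X](mul0r C); apply: cvgMl.
  by apply: cvg_powR_ninfty; rewrite subr_gt0.
Unshelve. all: by end_near. Qed.

Lemma finite_open_cover_neq0 (X : topologicalType) :
  @finite_open_cover X !=set0.
Proof.
exists [set setT]; split; first exact: finite_set1.
- by move=> _ ->; exact: openT.
- by rewrite bigcup_set1.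
Qed.

Lemma ln_nat_ge0 (R : realType) (n : nat) : (0 <= ln (n%:R : R))%R.
Proof. by case: n => [|n]; [rewrite ln0 | rewrite ln_ge0// ler1n]. Qed.

(** Each cover contributes the value [0] to the supremum at [t].  That the
    supremum itself is [0], and not [-oo], uses that a finite open cover
    exists. *)
Lemma upper_entropy_eq0 (R : realType) (X : topologicalType)
    (f : nat -> X -> X) (K : set X) (s t : R) :
  (s < t)%R -> upper_entropy f K s < +oo -> upper_entropy f K t = 0.
Proof.
move=> st hs.
have h0 U : @finite_open_cover X U -> limn_esup (fun n : nat =>
    ((n%:R `^ t)^-1 * ln (min_cover_number K (join_cover f U n))%:R)%:E) = 0.
  move=> oU; apply: (@limn_esup_powR_eq0 _ _ s) => // [n|].
    exact: ln_nat_ge0.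
  by apply: le_lt_trans hs; apply: ereal_sup_ubound; exists U.
apply/eqP; rewrite eq_le; apply/andP; split.
  by apply: ge_ereal_sup => _ [U oU <-]; rewrite h0.
have [U oU] := @finite_open_cover_neq0 X.
by apply: ereal_sup_ubound; exists U => //; rewrite h0.
Qed.

Lemma upper_entropy_dim_ge0 (R : realType) (X : topologicalType)
    (f : nat -> X -> X) (K : set X) : 0 <= upper_entropy_dim R f K.
Proof. by apply: le_ereal_inf_tmp => _ [s [s0 _] <-]; rewrite lee_fin ltW. Qed.

Section PesinComparison.
Context {R : realType} {X : topologicalType}.
Variables (f : nat -> X -> X) (K : set X).

Lemma pesin_M_nondecreasing (s : R) (U : set (set X)) (a : R) :
  nondecreasing_seq (pesin_M f K s U a).
Proof.
move=> m n mn; apply: ereal_inf_le_tmp => _ [G [cG GU KG Gn] <-].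
exists G => //; split=> // u Gu.
exact: leq_trans (Gn u Gu).
Qed.

Lemma pesin_M_ge0 (s : R) (U : set (set X)) (a : R) (N : nat) :
  0 <= pesin_M f K s U a N.
Proof.
apply: le_ereal_inf_tmp => _ [G _ <-].
by apply: esum_ge0 => u _; rewrite lee_fin expR_ge0.
Qed.

Lemma pesin_m_ge0 (s : R) (U : set (set X)) (a : R) : 0 <= pesin_m f K s U a.
Proof.
apply: lime_ge; first exact/ereal_nondecreasing_is_cvgn/pesin_M_nondecreasing.
by apply: nearW => N; exact: pesin_M_ge0.
Qed.

(** Strings are nonempty, so their lengths are at least [1] and larger
    exponents make the weights smaller, provided that the coefficient [b] is
    nonnegative: a negative one would reverse the comparison. *)
Lemma le_pesin_m (s t a b : R) (U : set (set X)) :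
  (s <= t)%R -> (a <= b)%R -> (0 <= b)%R ->
  pesin_m f K t U b <= pesin_m f K s U a.
Proof.
move=> st ab b0.
apply: lee_lim; [exact/ereal_nondecreasing_is_cvgn/pesin_M_nondecreasing..|].
apply: nearW => N; apply: le_ereal_inf_tmp => _ [G GP <-].
have [_ GU _ _] := GP.
apply: ge_ereal_inf; eexists; first by exists G.
apply: le_esum => u /GU[u0 _].
rewrite lee_fin ler_expR lerN2 (le_trans (ler_wpM2r _ ab)) ?powR_ge0//.
by rewrite ler_wpM2l// ler_powR// ler1n.
Qed.

(** Any [c] above the critical value at [s] and at least [0] bounds the
    critical value at [t]: for each cover the mass at [s] already vanishes at
    some [a < c], and [le_pesin_m] carries this to the mass at [t] and [c]. *)
Lemma pesin_D_lty (s t : R) :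
  (s <= t)%R -> pesin_D f K s < +oo -> pesin_D f K t < +oo.
Proof.
move=> st Ds.
have [c c0 Dc] : exists2 c : R, (0 <= c)%R & pesin_D f K s < c%:E.
  case: (pesin_D f K s) Ds => [r _|//|_]; last by exists 0%R; rewrite // ltNyr.
  exists (`|r| + 1)%R; first by rewrite addr_ge0.
  by rewrite lte_fin (le_lt_trans (ler_norm r))// ltrDl.
apply: (@le_lt_trans _ _ c%:E); last exact: ltry.
apply: ge_ereal_sup => _ [U oU <-].
have /ereal_inf_lt[_ [a ma0 <-] ac] : pesin_D_cover f K s U < c%:E.
  by apply: le_lt_trans Dc; apply: ereal_sup_ubound; exists U.
apply: ereal_inf_lbound; exists c; last by [].
apply/eqP; rewrite eq_le pesin_m_ge0 andbT -ma0.
by apply: le_pesin_m => //; rewrite -lee_fin ltW.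
Qed.

End PesinComparison.

Lemma pesin_dim_ge0 (R : realType) (X : topologicalType) (f : nat -> X -> X)
    (K : set X) : 0 <= pesin_dim R f K.
Proof.
rewrite /pesin_dim /nneg_ereal_sup; case: ifPn => // /set0P[x [s [s0 Ds] sx]].
apply: le_ereal_sup_tmp; exists x; first by exists s.
by rewrite -sx lee_fin ltW.
Qed.

Lemma le_pesin_dim (R : realType) (X : topologicalType) (f : nat -> X -> X)
    (K : set X) (s : R) :
  (0 < s)%R -> pesin_D f K s = +oo -> s%:E <= pesin_dim R f K.
Proof.
move=> s0 Ds; rewrite /pesin_dim /nneg_ereal_sup ifF.
  by apply: ereal_sup_ubound; exists s.
by apply/negbTE/set0P; exists s%:E; exists s.
Qed.

Lemma pesin_dim_le (R : realType) (X : topologicalType) (f : nat -> X -> X)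
    (K : set X) (t : R) :
  (0 <= t)%R -> pesin_D f K t < +oo -> pesin_dim R f K <= t%:E.
Proof.
move=> t0 Dt; rewrite /pesin_dim /nneg_ereal_sup; case: ifPn => // _.
apply: ge_ereal_sup => _ [s [_ Ds] <-]; rewrite lee_fin leNgt; apply/negP => ts.
by have := @pesin_D_lty _ _ f K _ _ (ltW ts) Dt; rewrite Ds ltxx.
Qed.

Theorem theorem4p4 (R : realType) (X : topologicalType) (f : nat -> X -> X)
    (K : set X)
    (X_compact : compact [set: X])
    (f_cont : forall i : nat, (1 <= i)%N -> continuous (f i))
    (K_neq0 : K !=set0) :
  [/\ top_entropy R f K < +oo ->
        0 <= upper_entropy_dim R f K /\ upper_entropy_dim R f K <= 1,
      0 <= upper_entropy_dim R f K /\ upper_entropy_dim R f K < 1 ->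
        top_entropy R f K < +oo,
      pesin_D f K (1%R : R) < +oo ->
        0 <= pesin_dim R f K /\ pesin_dim R f K <= 1 &
      0 <= pesin_dim R f K /\ pesin_dim R f K < 1 ->
        pesin_D f K (1%R : R) < +oo].
Proof.
split.
- move=> h1; split; first exact: upper_entropy_dim_ge0.
  apply/lee_addgt0Pr => e e0; rewrite -EFinD.
  apply: ereal_inf_lbound; exists (1 + e)%R => //=.
  split; first by rewrite addr_gt0.
  by apply: upper_entropy_eq0 h1; rewrite ltrDl.
- move=> [_ /ereal_inf_lt[_ [s [_ hs0] <-]]]; rewrite lte_fin => s1.
  by rewrite /top_entropy (@upper_entropy_eq0 _ _ _ _ _ _ s1)// hs0.
- move=> D1; split; first exact: pesin_dim_ge0.
  exact: pesin_dim_le.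
- move=> [_ dim1]; rewrite ltey; apply/eqP => D1.
  by have := le_pesin_dim _ _ _ _ _ ltr01 D1; rewrite leNgt dim1.
Qed.
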